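(* For every octus $F$, we have $\text{mader}_{\vec{\chi}}(F)=v(F)$.
   Context: Digraphs are finite, have a nonempty vertex set, are loopless and have no parallel arcs, but may contain anti-parallel pairs of arcs $(x,y),(y,x)$ (digons). $v(D)$ denotes the number of vertices of a digraph $D$. An acyclic $k$-coloring of $D$ is a map $c:V(D)\to\{1,\dots,k\}$ such that each color class $c^{-1}(i)$ induces an acyclic subdigraph (one with no directed cycle; a digon is a directed cycle of length 2). The dichromatic number $\vec{\chi}(D)$ is the smallest $k\in\mathbb{N}$ for which $D$ has an acyclic $k$-coloring. A subdivision of a digraph $F$ is any digraph obtained by replacing every arc $(x,y)$ of $F$ by a directed path from $x$ to $y$ (of length at least 1), where the subdivision paths of different arcs are internally vertex-disjoint (and their internal vertices are new vertices). A digraph $D$ contains a subdivision of $F$ if some subdigraph of $D$ is isomorphic to a subdivision of $F$. $\text{mader}_{\vec{\chi}}(F)$ denotes the smallest integer $k\ge 1$ such that every digraph $D$ with $\vec{\chi}(D)\ge k$ contains a subdivision of $F$ (it is known that such a $k$ exists for every digraph $F$). The class of octi (singular: octus) is defined inductively: (1) $K_1$ (the one-vertex digraph) is an octus. (2) (Ear addition) Let $F$ be an octus, $v_0\in V(F)$, and let $P=v_1,\dots,v_k$, $k\ge 1$, be an orientation of a path, vertex-disjoint from $F$ (each consecutive pair $v_i,v_{i+1}$ is joined by exactly one arc, in an arbitrary direction). Let $F^*$ be obtained from $F$ by adding $P$, both arcs $(v_0,v_1),(v_1,v_0)$, and exactly one of the arcs $(v_0,v_k),(v_k,v_0)$. Then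 $F^*$ is an octus. (For $k=1$ this just attaches a new vertex $v_1$ to $v_0$ by a digon.) (3) Every subdigraph of an octus is an octus. *)

(* Defs.v *)
From mathcomp Require Import all_boot.
From mathcomp Require Import boolp.

Set Implicit Arguments.
Unset Strict Implicit.
Unset Printing Implicit Defensive.

Record digraph := Digraph {
  vertex :> finType;
  arc : rel vertex;
  arc_irr : irreflexive arc;
  vertex_gt0 : 0 < #|vertex| }.
Arguments arc {d}.

(* [G] is isomorphic to a (not necessarily induced) subdigraph of [D]. *)
Definition embeds (G D : digraph) : Prop :=
  exists2 f : G -> D, injective f & {homo f : x y / arc x y}.

(* [s] lists, without repetition and in cyclic order, the vertices of a
   directed cycle; as there are no loops, [size s] is at least 2, and size 2
   is a digon. *)
Definition dicycle (D : digraph) (s : seq D) : Prop :=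
  s != [::] /\ ucycle arc s.

(* The subdigraph induced by [A] is acyclic. It is phrased on the set [A]
   because [A] may be empty, whereas a [digraph] may not. *)
Definition acyclic (D : digraph) (A : {set D}) : Prop :=
  forall s : seq D, dicycle s -> ~ {subset s <= A}.

Definition acyclic_coloring (D : digraph) (k : nat) (c : D -> 'I_k) : Prop :=
  forall i : 'I_k, acyclic [set x | c x == i].

Definition dicolorable (D : digraph) (k : nat) : Prop :=
  exists c : D -> 'I_k, acyclic_coloring c.

Lemma dicolorable_card (D : digraph) : dicolorable D #|D|.
Proof.
exists enum_rank => i s [s_neq0 /andP[cs us]] sA.
have sE x : x \in s -> x = enum_val i.
  by move=> /sA; rewrite inE => /eqP <-; rewrite enum_rankK.
case: s s_neq0 cs us {sA} sE => // x [|y s] _ /= cs us sE.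
  by rewrite arc_irr in cs.
have xy : x = y by apply: etrans (sE x _) (esym (sE y _)); rewrite !inE eqxx ?orbT.
by rewrite xy !inE eqxx in us.
Qed.

Lemma ex_dicolorable (D : digraph) : exists k, `[< dicolorable D k >].
Proof. by exists #|D|; apply/asboolP/dicolorable_card. Qed.

Definition dichromatic (D : digraph) : nat := ex_minn (ex_dicolorable D).

Section Subdivision.

Variable F : digraph.

Definition arc_of : finType := {a : F * F | arc a.1 a.2}.

Variable l : arc_of -> nat.

(* The arc [a] is replaced by a directed path with [l a] internal vertices,
   which are the [inr (Tagged _ i)] with tag [a], in increasing order of [i]. *)
Definition subdiv_vertex : finType := (F + {a : arc_of & 'I_(l a)})%type.

Definition subdiv_arc : rel subdiv_vertex := fun u w =>
  match u, w with
  | inl x, inl y => [exists a : arc_of, (val a == (x, y)) && (l a == 0)]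
  | inl x, inr q => (x == (val (tag q)).1) && (tagged q == 0 :> nat)
  | inr p, inl y => (y == (val (tag p)).2) && ((tagged p).+1 == l (tag p))
  | inr p, inr q => (tag p == tag q) && (tagged q == (tagged p).+1 :> nat)
  end.

Lemma subdiv_irr : irreflexive subdiv_arc.
Proof.
case=> [x|p] /=; last by rewrite (ltn_eqF (ltnSn _)) andbF.
apply/existsP => -[a /andP[/eqP ax _]].
by move: (valP a) => /=; rewrite [sval a]ax /= arc_irr.
Qed.

Lemma subdiv_gt0 : 0 < #|subdiv_vertex|.
Proof. by rewrite card_sum ltn_addr ?vertex_gt0. Qed.

Definition subdivision : digraph := Digraph subdiv_irr subdiv_gt0.

End Subdivision.

Definition contains_subdivision (D F : digraph) : Prop :=
  exists l : arc_of F -> nat, embeds (subdivision l) D.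

Definition mader_bound (F : digraph) (k : nat) : Prop :=
  1 <= k /\
  forall D : digraph, k <= dichromatic D -> contains_subdivision D F.

(* [mader F = k]: [k] is the smallest integer with the defining property.
   A relation, so that no default value is needed. *)
Definition is_mader (F : digraph) (k : nat) : Prop :=
  mader_bound F k /\ forall j, mader_bound F j -> k <= j.

Section Ear.

Variables (F : digraph) (v0 : F) (k : nat) (o : 'I_k -> bool) (b : bool).

(* The path has [k.+1] vertices [inr 0, ..., inr k]. For [i : 'I_k], [o i]
   says whether the [i]-th edge is the arc from [inr i] to [inr i.+1] or the
   reverse one; [b] says whether the last arc is from [v0] to [inr k] or the
   reverse one. When [k] is 0, that arc is already in the digon. *)
Definition ear_vertex : finType := (F + 'I_k.+1)%type.

Definition ear_arc : rel ear_vertex := fun u w =>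
  match u, w with
  | inl x, inl y => arc x y
  | inl x, inr j => (x == v0) && ((j == 0 :> nat) || b && (j == k :> nat))
  | inr i, inl y => (y == v0) && ((i == 0 :> nat) || ~~ b && (i == k :> nat))
  | inr i, inr j =>
      [exists m : 'I_k, if o m
        then (i == m :> nat) && (j == m.+1 :> nat)
        else (j == m :> nat) && (i == m.+1 :> nat)]
  end.

Lemma ear_irr : irreflexive ear_arc.
Proof.
case=> [x|i] /=; first exact: arc_irr.
apply/existsP => -[m].
by case: ifP => _ /andP[/eqP->]; rewrite (ltn_eqF (ltnSn _)).
Qed.

Lemma ear_gt0 : 0 < #|ear_vertex|.
Proof. by rewrite card_sum ltn_addr ?vertex_gt0. Qed.

Definition ear : digraph := Digraph ear_irr ear_gt0.

End Ear.

(* The class is closed under isomorphism, through [octus_sub]. *)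
Inductive octus : digraph -> Prop :=
| octus_K1 (D : digraph) : #|D| = 1 -> octus D
| octus_ear (F : digraph) (v0 : F) (k : nat) (o : 'I_k -> bool) (b : bool) :
    octus F -> octus (ear v0 o b)
| octus_sub (F G : digraph) : octus F -> embeds G F -> octus G.

(* Main.v *)
(* The lower bound comes from complete digraphs. For the upper bound, an ear
   with K path vertices is added at v0 as follows. Let D need at least
   v(F) + K colours and let X be a maximal K-colourable set of vertices of D.
   Then D - X still needs v(F) colours, so it contains a subdivision of F; let
   v be its branch vertex for v0. As X + v is not K-colourable, it suffices to
   find a subdivided ear rooted at v in X + v.

   Fix a K-colouring of X by 1, ..., K and give v colour 0. List the path
   vertices from the one joined to v0 by a single arc to the one in the digon.
   Layer 0 is {v}, and layer n consists of the vertices outside layers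
   0, ..., n - 1, of colour at most n, that are reachable from layer n - 1, by
   a path inside layer n, along the n-th prescribed direction. Shift the
   colours in the layers cyclically: i becomes i + 1, and K becomes 1. Some
   cycle Z becomes monochromatic. Walking along Z in the direction attached to
   its lowest layers, one never leaves the layers, so that Z would have been
   monochromatic before, unless Z goes through v. Then Z has colour 1, and the
   neighbour of v on Z in the first direction lies in layer K. Tracing that
   neighbour back through the layers, and cutting the last path at its first
   vertex on Z, yields the ear: Z is the subdivided digon, and it meets none of
   the layers 1, ..., K - 1.

   Closure under subdigraphs is dealt with by forcing every induced subdigraph
   of an octus: what is left of an ear after deleting vertices is contained in
   a shorter ear, possibly rooted elsewhere. *)
Require Import Defs.
From mathcomp Require Import all_boot.
From mathcomp Require Import boolp.
(* Shadows [path.arc]. *)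
Import Defs.
Set Implicit Arguments.
Unset Strict Implicit.
Unset Printing Implicit Defensive.

(** * Propagation along cycles *)

Lemma cycle_closed (T : eqType) (e : rel T) (s : seq T) (P : pred T) (x : T) :
  cycle e s -> x \in s -> P x ->
  (forall y z, y \in s -> z \in s -> e y z -> P y -> P z) ->
  {in s, forall y, P y}.
Proof.
move=> cs xs Px HP.
have [i s' Es] := rot_to xs.
have sE : s =i x :: s' by move=> y; rewrite -(mem_rot i) Es.
move: cs; rewrite -(rot_cycle i) Es /= => cs y; rewrite sE.
have HP' : forall y z, y \in x :: s' -> z \in x :: s' -> e y z -> P y -> P z.
  by move=> a b; rewrite -!sE; apply: HP.
move: HP' => {}HP.
have {cs} : path e x s' by move: cs; rewrite rcons_path => /andP[].
elim: s' {sE Es xs} x Px HP => [|b l IH] x Px HP /=; first by rewrite inE => _ /eqP->.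
move=> /andP[exb pl]; rewrite inE => /predU1P[-> //|].
apply: IH => //; first by apply: HP exb Px; rewrite !inE eqxx ?orbT.
by move=> a d ha hd; apply: HP; rewrite inE ?ha ?hd orbT.
Qed.

Lemma path_all (T : Type) (e : rel T) (P : pred T) (x : T) p :
  (forall a b, e a b -> P b) -> path e x p -> all P p.
Proof. by move=> H; elim: p x => //= y p IH x /andP[/H -> /IH]. Qed.

(* Colours start at 1; colour 0 is kept for the root in [Section Rooted]. *)
Definition colorable (D : digraph) (Y : {set D}) (k : nat) : Prop :=
  exists c : D -> nat, {in Y, forall z, 0 < c z <= k} /\
    forall s, dicycle s -> {subset s <= Y} -> forall i, ~ {in s, forall z, c z = i}.

(** * Layers around a root, and the cyclic shift of colours *)

Section Rooted.

Variables (D : digraph) (X : {set D}) (v : D) (K : nat) (c : D -> nat).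
Variable (dir : nat -> bool).

(** [dir n] says whether the [n]-th edge, counted from the single-arc end, points away from the
    root. *)
Definition step n : rel D := fun x y => if dir n then arc x y else arc y x.

(** A dicycle can be walked either way: for backward steps, the reversed list is a cycle of the
    converse relation. *)
Lemma cycle_step_closed n s (P : pred D) x :
  cycle arc s -> x \in s -> P x ->
  (forall y z, y \in s -> z \in s -> step n y z -> P y -> P z) ->
  {in s, forall y, P y}.
Proof.
move=> cs xs Px HP; case Ed: (dir n).
  by apply: (cycle_closed cs xs Px) => y z ys zs yz; apply: HP; rewrite // /step Ed.
have crs : cycle (fun y z => arc z y) (rev s) by rewrite rev_cycle.
have xrs : x \in rev s by rewrite mem_rev.
move=> a; rewrite -mem_rev; apply: (cycle_closed crs xrs Px) => y z.
by rewrite !mem_rev => ys zs yz; apply: HP; rewrite // /step Ed.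
Qed.

Hypothesis cv : c v = 0.
Hypothesis cX : forall z, z \in X -> 0 < c z <= K.

Definition layer_step (l : D -> nat) n : rel D :=
  fun y y' => [&& step n.+1 y y', n < l y', y' \in X & c y' <= n.+1].

(* [layer n z] is the index of the layer of [z], or [n.+1] if [z] lies in none
   of the layers [0, ..., n]. *)
Fixpoint layer n (z : D) : nat :=
  if n is n'.+1 then
    if layer n' z <= n' then layer n' z else
    if [exists x, (layer n' x == n') && connect (layer_step (layer n') n') x z]
    then n else n.+1
  else z != v.

Local Notation stepl n := (layer_step (layer n) n).

Lemma layerS n z : layer n.+1 z =
  if layer n z <= n then layer n z else
    if [exists x, (layer n x == n) && connect (stepl n) x z] then n.+1 else n.+2.
Proof. by []. Qed.

Lemma layer_le n z : layer n z <= n.+1.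
Proof.
elim: n => [|n IH]; first by rewrite /=; case: (_ == _).
rewrite layerS; case: ifP => [h|_]; last by case: ifP.
by rewrite (leq_trans h) // ltnW.
Qed.

(** An index once given is never revised, so [layer K] determines all earlier stages by
    truncation. *)
Lemma layer_min n m z : n <= m -> layer n z = minn (layer m z) n.+1.
Proof.
elim: m => [|m IH].
  by rewrite leqn0 => /eqP->; apply/esym/minn_idPl/layer_le.
rewrite leq_eqVlt => /predU1P[->|nm]; first by apply/esym/minn_idPl/layer_le.
rewrite IH // layerS; case: leqP => // hm.
have -> : minn (layer m z) n.+1 = n.+1 by apply/minn_idPr; rewrite (leq_trans nm).
apply/esym/minn_idPr; case: ifP => _; first by [].
by rewrite ltnW.
Qed.

Local Notation rho := (layer K).

Lemma rho_le n z i : n <= K -> i <= n -> (layer n z <= i) = (rho z <= i).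
Proof.
move=> nK iN; rewrite (layer_min z nK) geq_min [n < i]ltnNge iN orbF //.
Qed.

Lemma rho_eq n z i : n <= K -> i <= n -> (layer n z == i) = (rho z == i).
Proof.
move=> nK iN; rewrite !eqn_leq rho_le //; congr (_ && _).
case: i iN => // i iN.
by rewrite !ltnNge rho_le // ltnW.
Qed.

Lemma rho0 z : (rho z == 0) = (z == v).
Proof. by rewrite -(@rho_eq 0) //=; case: (z == v). Qed.

Lemma rho_col z : rho z <= K -> c z <= rho z /\ (z != v -> z \in X).
Proof.
case E : (rho z) => [|n] nK.
  by move/eqP: E; rewrite rho0 => /eqP->; rewrite cv eqxx.
have : layer n.+1 z == n.+1 by rewrite rho_eq // E.
have : n < layer n z by rewrite ltnNge rho_le ?E -?ltnNge // ltnW.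
move=> nz; rewrite layerS [layer n z <= n]leqNgt nz /=.
case: ifP => [/existsP[x /andP[/eqP xn]]|_]; last by rewrite (gtn_eqF (ltnSn _)).
move=> /connectP[p + Ez] _.
case/lastP: p Ez => [|p y]; first by move=> Ez; move: nz; rewrite Ez /= xn ltnn.
rewrite last_rcons => <-; rewrite rcons_path => /andP[_].
by case/and4P.
Qed.

(** If [y] is in no layer up to [n], appending the step to a path from layer [n] to [x] puts it in
    layer [n.+1]. *)
Lemma rho_closed n x y : n < K -> n <= rho x <= n.+1 -> step n.+1 x y ->
  y \in X -> c y <= n.+1 -> rho y <= n.+1.
Proof.
move=> nK /andP[nx xn] xy yX cy.
rewrite -(@rho_le n.+1) // layerS.
case: (leqP (layer n y) n) => hy; first by rewrite ltnW.
have sxy : stepl n x y by rewrite /layer_step xy hy yX.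
suff -> : [exists x, (layer n x == n) && connect (stepl n) x y] by [].
move: nx; rewrite leq_eqVlt => /predU1P[Ex|nx].
  by apply/existsP; exists x; rewrite (rho_eq _ (ltnW nK)) // -Ex eqxx connect1.
have : layer n.+1 x == n.+1 by rewrite rho_eq // eqn_leq xn.
rewrite layerS [layer n x <= n]leqNgt ltnNge rho_le ?(ltnW nK) // -ltnNge nx /=.
case: ifP => [/existsP[t /andP[tn ct]] _|]; last by rewrite (gtn_eqF (ltnSn _)).
by apply/existsP; exists t; rewrite tn (connect_trans ct) ?connect1.
Qed.

Lemma rho_path n z : n < K -> rho z = n.+1 ->
  exists x p, [/\ rho x = n, path (step n.+1) x (rcons p z),
    uniq (rcons p z) & {in p, forall y, rho y = n.+1}].
Proof.
move=> nK Ez.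
have nz : n < layer n z by rewrite ltnNge rho_le ?(ltnW nK) // -ltnNge Ez.
have : layer n.+1 z == n.+1 by rewrite rho_eq // Ez.
rewrite layerS [layer n z <= n]leqNgt nz /=.
case: ifP => [/existsP[x /andP[xn]]|_]; last by rewrite (gtn_eqF (ltnSn _)).
move=> /connectP[p pp lz] _; case/shortenP: pp lz => q pq uq _ lz.
have Ex : rho x = n by apply/eqP; rewrite -(@rho_eq n) // ltnW.
case/lastP: q pq uq lz => [|q y]; first by move=> _ _ /= Ezx; case: (n_Sn n); rewrite -Ez -Ex Ezx.
rewrite last_rcons => pq /= /andP[_ uq] Ey; rewrite -{y}Ey in pq uq *.
exists x, q; split => //; first by apply: sub_path pq => a b /and4P[].
move=> a aq; have : layer n.+1 a == n.+1; last by rewrite rho_eq // => /eqP.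
have ca : connect (stepl n) x a.
  by apply: (path_connect pq); rewrite inE mem_rcons inE aq !orbT.
rewrite layerS.
have na : n < layer n a.
  have H b d : stepl n b d -> n < layer n d by case/and4P.
  by apply: (allP (path_all H pq)); rewrite mem_rcons inE aq orbT.
rewrite [layer n a <= n]leqNgt na /=.
by have -> : [exists x, (layer n x == n) && connect (stepl n) x a]
  by apply/existsP; exists x; rewrite xn.
Qed.

Hypothesis Xcol : forall s, dicycle s -> {subset s <= X} ->
  forall i, ~ {in s, forall z, c z = i}.
Hypothesis K0 : 0 < K.

Definition shifted z := if rho z <= K then if c z == K then 1 else (c z).+1 else c z.

Lemma cycle_nbr n s x : cycle arc s -> x \in s -> exists2 y, y \in s & step n x y.
Proof.
move=> cs xs; rewrite /step; case: (dir n).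
  by exists (next s x); [rewrite mem_next | apply: next_cycle].
by exists (prev s x); [rewrite mem_prev | apply: prev_cycle].
Qed.

Lemma rho_v : rho v = 0.
Proof. by apply/eqP; rewrite rho0. Qed.

Lemma step_irr n x : step n x x = false.
Proof. by rewrite /step arc_irr if_same. Qed.

Lemma shifted_cycle s i :
  dicycle s -> {subset s <= v |: X} -> {in s, forall z, shifted z = i} ->
  [/\ v \in s, {in s, forall z, z != v -> K <= rho z} &
      exists y, [/\ y \in s, y != v, step 1 v y & rho y = K]].
Proof.
move=> ds sX si; case: (ds) => s0 /andP[cs us].
have inX z : z \in s -> z != v -> z \in X.
  by move=> /sX; rewrite !inE => /predU1P[->|//]; rewrite eqxx.
have [vs|vs] := boolP (v \in s).
  have i1 : i = 1 by rewrite -(si _ vs) /shifted rho_v cv leq0n; case: eqP.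
  (* In a layer, shifted colour 1 comes from [K], as colour 0 is the root's alone; and the colour of
     a vertex never exceeds its layer index. *)
  have hR z : z \in s -> z != v -> K <= rho z.
    move=> zs zv; move: (si _ zs); rewrite /shifted i1; case: leqP => [zK|/ltnW //].
    case: eqP => [cz _|_ [cz]]; first by have [] := rho_col zK; rewrite cz.
    by have := cX (inX _ zs zv); rewrite cz.
  split=> //; have [y ys vy] := cycle_nbr 1 cs vs.
  have yv : y != v by apply/eqP => E; rewrite E step_irr in vy.
  exists y; split=> //; apply/eqP; rewrite eqn_leq hR // andbT.
  (* Outside the layers [y] would have kept colour 1, and as a [step 1] neighbour of the root it
     would lie in layer 1. *)
  rewrite leqNgt; apply/negP => Ky; move: (si _ ys).
  rewrite /shifted leqNgt Ky i1 /= => cy.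
  have : rho y <= 1 by apply: (@rho_closed 0 v); rewrite ?rho_v ?cy ?inX.
  by move=> /leq_trans/(_ K0); rewrite leqNgt Ky.
have {}inX z : z \in s -> z \in X.
  by move=> zs; apply: inX => //; apply: contraNneq vs => <-.
have [hR|nR] := boolP (has (fun z => rho z <= K) s); last first.
  case: (Xcol ds inX (i := i)) => z zs; have := si _ zs.
  by rewrite /shifted ifN //; apply: contra nR => zK; apply/hasP; exists z.
(* The rotation of colours is injective, so a cycle inside the layers would have been monochromatic
   under [c]. *)
have allR : {in s, forall z, rho z <= K} -> False.
  move=> h; apply: (Xcol ds inX (i := if i == 1 then K else i.-1)) => z zs.
  have /andP[cz _] := cX (inX _ zs).
  by have := si _ zs; rewrite /shifted h //; case: eqP => [-> <- //|_ <-] /=; case: (c z) cz.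
have ex_j : exists j, has (fun z => rho z == j) s.
  by case/hasP: hR => x xs _; exists (rho x); apply/hasP; exists x.
case: (ex_minnP ex_j) => j /hasP[x xs /eqP xj] jmin.
have {}jmin z : z \in s -> j <= rho z by move=> zs; apply: jmin; apply/hasP; exists z.
have xK : rho x <= K.
  by case/hasP: hR => z zs zK; rewrite xj (leq_trans _ zK) ?jmin.
have [cx _] := rho_col xK; have /andP[cx0 cxK] := cX (inX _ xs).
(* Vertices of [s] in layers [t.-1] and [t] have all their [step t] neighbours
   on [s] in these layers, since the colours on [s] are at most [t]. *)
have [t Et] : exists t, t = if i == 1 then K else maxn j i by eexists.
have [t0 tK] : 0 < t /\ t <= K.
  rewrite Et; case: eqP => // i1; rewrite geq_max -xj xK /=.
  have := si _ xs; rewrite /shifted xK; case: eqP => [_ /esym//|/eqP cK <-].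
  by rewrite leq_max orbT ltn_neqAle cK.
(* The colour of [x] is at most [j], and it is [K] if [i] is 1 and [i.-1] otherwise. So [x] lies in
   layer [t.-1] or [t]. *)
have jt : t <= j.+1 /\ j <= t.
  rewrite Et; have := si _ xs; rewrite /shifted xK -xj.
  case: eqP => [cK <- /=|cK <-]; first by split=> //; rewrite leqW // -{1}cK.
  by case: eqP => [[c0]|_]; [rewrite c0 in cx0 | rewrite geq_max leqnSn ltnS cx leq_maxl; split].
case: jt => tj jt.
case: t Et t0 tK tj jt => // n En _ nK nj jn.
case: allR => z zs; apply: leq_trans (_ : n.+1 <= K) => //.
have jn' : rho x <= n.+1 by rewrite xj.
move: z zs; apply: (@cycle_step_closed n.+1 s (fun z => rho z <= n.+1) x) => // y z ys zs yz hy.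
apply: (rho_closed nK (x := y)); rewrite ?hy ?inX ?andbT //.
  by rewrite -ltnS (leq_trans nj) // ltnS jmin.
have /andP[c0 cK] := cX (inX _ zs).
rewrite En; case: eqP => // i1; have := si _ zs; rewrite /shifted.
case: ifP => _; last by move=> ->; rewrite leq_maxr.
by case: eqP => [_ /esym//|_ <-]; rewrite leq_max leqnSn orbT.
Qed.

End Rooted.

(** * From the monochromatic cycle to a rooted ear *)

Lemma layer_trace (D : digraph) (X : {set D}) (v : D) (K : nat) (c : D -> nat)
    (dir : nat -> bool) (n : nat) (z : D) :
  n <= K -> layer X v c dir K z = n ->
  exists (x : nat -> D) (p : nat -> seq D), [/\ x 0 = v, x n = z &
    forall m, 0 < m <= n -> [/\ layer X v c dir K (x m) = m,
      path (step dir m) (x m.-1) (rcons (p m) (x m)), uniq (rcons (p m) (x m)) &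
      {in p m, forall y, layer X v c dir K y = m}]].
Proof.
elim: n z => [|n IH] z nK Ez.
  exists (fun=> v), (fun=> [::]); split=> // [|[|m]] //.
  by apply/esym/eqP; rewrite -(rho0 X v K c dir) Ez.
have [x' [q [x'n pq uq qn]]] := rho_path nK Ez.
have [x [p [x0 xn xp]]] := IH x' (ltnW nK) x'n.
exists (fun m => if m == n.+1 then z else x m), (fun m => if m == n.+1 then q else p m).
split; rewrite ?eqxx // => m /andP[m0 mn] /=.
have [->|nm] := eqVneq m n.+1; first by rewrite /= (ltn_eqF (ltnSn n)) xn.
have {}mn : m <= n by rewrite -ltnS ltn_neqAle nm.
have -> : (m.-1 == n.+1) = false by rewrite ltn_eqF // ltnS (leq_trans (leq_pred _)).
by apply: xp; rewrite m0.
Qed.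

(* [lab] certifies that the vertices [x n] with [0 < n <= K], the inner vertices
   of the paths [p n], and those of [q1] and [q2] are all distinct. *)
Lemma rooted_ear (D : digraph) (X : {set D}) (v : D) (K : nat) (dir : nat -> bool) :
  v \notin X -> 0 < K -> colorable X K -> ~ colorable (v |: X) K ->
  exists (x : nat -> D) (p : nat -> seq D) (q1 q2 : seq D) (lab : D -> nat * nat),
  [/\ x 0 = v,
      forall n, 0 < n <= K -> [/\ x n \in X, lab (x n) = (0, n),
        path (step dir n) (x n.-1) (rcons (p n) (x n)), uniq (p n) &
        {in p n, forall z, z \in X /\ lab z = (1, n)}],
      [/\ path arc v (rcons q1 (x K)), uniq q1 &
        {in q1, forall z, z \in X /\ lab z = (2, 0)}] &
      [/\ path arc (x K) (rcons q2 v), uniq q2 &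
        {in q2, forall z, z \in X /\ lab z = (3, 0)}]].
Proof.
move=> vX K0 [c0 [c0X Xc0]] ncol.
pose c z := if z == v then 0 else c0 z.
have cv : c v = 0 by rewrite /c eqxx.
have cE z : z \in X -> c z = c0 z.
  by move=> zX; rewrite /c ifN //; apply: contraNneq vX => <-.
have cX z : z \in X -> 0 < c z <= K by move=> zX; rewrite cE ?c0X.
have Xcol s : dicycle s -> {subset s <= X} -> forall i, ~ {in s, forall z, c z = i}.
  by move=> ds sX i si; apply: (Xc0 s ds sX i) => z zs; rewrite -cE ?si ?sX.
pose rho := layer X v c dir K; pose sh := shifted X v K c dir.
have rv : rho v = 0 by apply: rho_v.
have [s [i [ds sX si]]] : exists s i,
    [/\ dicycle s, {subset s <= v |: X} & {in s, forall z, sh z = i}].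
  apply: contrapT => H; apply: ncol; exists sh; split; last first.
    by move=> s ds sX i si; apply: H; exists s, i.
  move=> z; rewrite !inE /sh /shifted => /predU1P[->|/cX /andP[z0 zK]].
    by rewrite -/rho rv cv; case: eqP.
  case: ifP => _; last by rewrite z0.
  by case: eqP => [_|/eqP cK] //=; rewrite ltn_neqAle cK.
have [vs sK [y [ys yv vy yK]]] := shifted_cycle cv cX Xcol K0 ds sX si.
(* [y'] is the first vertex on [s] of a path from layer [K.-1] to [y], so that [q] avoids [s]; for
   [K] equal to 1, the edge from [v] to [y] serves. *)
have [x' [q [y' [x'K pq uq [y's y'v] [y'K qK qs]]]]] : exists x' q y',
  [/\ rho x' = K.-1, path (step dir K) x' (rcons q y'), uniq (rcons q y'),
     y' \in s /\ y' != v & [/\ rho y' = K, {in q, forall z, rho z = K} &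
     {in q, forall z, z \notin s}]].
  have [K1|K1] := eqVneq K 1.
    by exists v, [::], y; rewrite -/rho K1 in rv yK *; split=> //=; rewrite vy.
  have K'K : K.-1 < K by rewrite prednK.
  have [|x' [q [x'K pq uq qK]]] := @rho_path _ X v K c dir K.-1 y K'K.
    by rewrite prednK.
  rewrite prednK // in pq qK.
  have hs : has (mem s) (rcons q y) by rewrite has_rcons /= ys.
  have qyK z : z \in rcons q y -> rho z = K.
    by rewrite mem_rcons inE => /predU1P[->|/qK].
  case: (split_find hs) pq uq qyK => y' q1 q2 /= y's nq1.
  rewrite cat_path cat_uniq => /andP[pq _] /andP[uq _] qyK.
  have q1K z : z \in rcons q1 y' -> rho z = K by move=> zq; rewrite qyK // mem_cat zq.
  have y'K : rho y' = K by rewrite q1K // mem_rcons mem_head.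
  exists x', q1, y'; split=> //.
    by split=> //; apply/eqP => E; rewrite E rv in y'K; rewrite -y'K in K0.
  split=> // z zq; first by rewrite q1K // mem_rcons inE zq orbT.
  by apply: contra nq1 => zs; apply/hasP; exists z.
have [x [p [x0 xK' xp]]] := layer_trace (leq_pred K) x'K.
have rX z n : rho z = n -> 0 < n <= K -> z \in X.
  move=> <- /andP[z0 zK]; have [_] := rho_col cv zK; apply.
  by apply: contraTneq z0 => ->; rewrite rv.
have rs z n : rho z = n -> 0 < n < K -> z \notin s.
  move=> <- /andP[z0 zK]; apply/negP => /sK; rewrite leqNgt zK => H.
  by case: eqP H z0 => [->|_ /(_ isT)//]; rewrite rv.
case: ds => _ /andP[cs us].
have [j s' Es] := rot_to vs.
have sE z : (z \in s) = (z \in v :: s') by rewrite -(mem_rot j) Es.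
have {}us : uniq (v :: s') by rewrite -Es rot_uniq.
have {}cs : cycle arc (v :: s') by rewrite -Es rot_cycle.
have y's' : y' \in s' by move: y's; rewrite sE inE (negPf y'v).
(* The root and [y'] cut the cycle into the two paths of the subdivided digon. *)
case/path.splitP: y's' sE us cs => q1 q2 sE.
rewrite /= rcons_cat cat_path last_rcons cat_uniq rcons_uniq mem_cat mem_rcons inE.
rewrite !negb_or => /and4P[/andP[/andP[_ vq1] vq2] /andP[y'q1 uq1] nq uq2] /andP[pq1 pq2].
have y'q2 : y' \notin q2.
  by apply: contra nq => h; apply/hasP; exists y'; rewrite ?mem_rcons ?mem_head.
have q12 z : z \in q2 -> z \notin q1.
  by move=> zq2; apply: contra nq => h; apply/hasP; exists z; rewrite // mem_rcons inE h orbT.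
pose x_ n := if n == K then y' else x n.
(* Off the cycle the layer index tells the paths apart; on it, membership in [q1] separates the two
   sides. *)
pose lab z := if z \in s then if z == y' then (0, K) else if z \in q1 then (2, 0) else (3, 0)
  else if z == x_ (rho z) then (0, rho z) else (1, rho z).
exists x_, (fun n => if n == K then q else p n), q1, q2, lab.
rewrite /x_ eqxx (ltn_eqF K0); split=> //; last 2 first.
- split=> // z zq; have zs : z \in s by rewrite sE !(inE, mem_cat, mem_rcons) zq !orbT.
  have zv : z != v by apply: contraNneq vq1 => <-.
  split; first by have := sX _ zs; rewrite !inE (negPf zv).
  by rewrite /lab zs zq ifN //; apply: contraNneq y'q1 => <-.
- split=> // z zq; have zs : z \in s by rewrite sE !(inE, mem_cat, mem_rcons) zq !orbT.
  have zv : z != v by apply: contraNneq vq2 => <-.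
  split; first by have := sX _ zs; rewrite !inE (negPf zv).
  by rewrite /lab zs (negPf (q12 _ zq)) ifN //; apply: contraNneq y'q2 => <-.
move=> n /andP[n0 nK].
have pn : (n.-1 == K) = false by rewrite ltn_eqF // prednK.
rewrite pn; have [En|nneK] := eqVneq n K.
  rewrite En xK'; split=> //.
  - by apply: rX y'K _; rewrite K0 leqnn.
  - by rewrite /lab y's eqxx.
  - by move: uq; rewrite rcons_uniq => /andP[].
  move=> z zq; split; first by apply: rX (qK _ zq) _; rewrite K0 leqnn.
  by rewrite /lab (negPf (qs _ zq)) qK // /x_ eqxx ifN //; apply: contraNneq (qs _ zq) => ->.
have {}nK : n < K by rewrite ltn_neqAle nneK.
have nK' : 0 < n <= K.-1 by rewrite n0 -ltnS prednK.
have [xn px ux pn'] := xp n nK'.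
split=> //.
- by apply: rX xn _; rewrite n0 ltnW.
- by rewrite /lab (negPf (rs _ _ xn _)) ?n0 // /rho xn /x_ (negPf nneK) eqxx.
- by move: ux; rewrite rcons_uniq => /andP[].
move=> z zp; split; first by apply: rX (pn' _ zp) _; rewrite n0 ltnW.
rewrite /lab (negPf (rs _ _ (pn' _ zp) _)) ?n0 // /rho pn' // /x_ (negPf nneK) ifN //.
by move: ux; rewrite rcons_uniq => /andP[h _]; apply: contraNneq h => <-.
Qed.

(** * Forcing, and the addition of an ear *)

Lemma colorableU (D : digraph) (X Y : {set D}) (k l : nat) :
  colorable X k -> colorable (Y :\: X) l -> colorable Y (k + l).
Proof.
move=> [c1 [c1X Xc1]] [c2 [c2Y Yc2]].
(* The palettes are disjoint, so a monochromatic cycle lies within [X] or within [Y :\: X]. *)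
exists (fun z => if z \in X then c1 z else k + c2 z); split.
  move=> z zY; case: ifPn => zX.
    by have /andP[-> h] := c1X _ zX; rewrite (leq_trans h) ?leq_addr.
  have /andP[h1 h2] : 0 < c2 z <= l by apply: c2Y; rewrite inE zX.
  by rewrite leq_add2l h2 (leq_trans h1) // leq_addl.
move=> s ds sY i si.
have inXi z : z \in s -> (z \in X) = (i <= k).
  move=> zs; have := si _ zs; case: ifPn => zX <-.
    by have /andP[_ ->] := c1X _ zX.
  have /andP[h1 _] : 0 < c2 z <= l by apply: c2Y; rewrite inE zX sY.
  by rewrite leqNgt -{1}[k]addn0 ltn_add2l h1.
have [ik|ik] := leqP i k.
  by apply: (Xc1 s ds _ i) => z zs; [|have := si _ zs]; rewrite inXi ?ik.
apply: (Yc2 s ds _ (i - k)) => z zs; first by rewrite inE sY // inXi // -ltnNge ik.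
by have := si _ zs; rewrite inXi // leqNgt ik /= => <-; rewrite addKn.
Qed.

Lemma colorable0 (D : digraph) k : colorable (set0 : {set D}) k.
Proof.
exists (fun=> 0); split=> [z|s [s0 _] ss i _]; first by rewrite inE.
by case: s s0 ss => // x s _ /(_ x (mem_head _ _)); rewrite inE.
Qed.

(* [own] certifies that the branch vertices [f u] and the inner vertices of the
   paths [P u w] are all distinct. *)
Definition subdivides (F D : digraph) (S : {set F}) (Y : {set D}) : Prop :=
  exists (f : F -> D) (P : F -> F -> seq D) (own : D -> F + F * F),
    {in S, forall u, f u \in Y /\ own (f u) = inl u} /\
    {in S &, forall u w, arc u w -> [/\ path arc (f u) (rcons (P u w) (f w)),
      uniq (P u w) & {in P u w, forall z, z \in Y /\ own z = inr (u, w)}]}.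

(** Sets on both sides spare the passage to induced subdigraphs, such as that on [Y :\: X] in the
    induction. *)
Definition forced (F : digraph) (S : {set F}) : Prop :=
  forall (D : digraph) (Y : {set D}),
    (forall k, colorable Y k -> #|S| <= k) -> subdivides S Y.

(** [s] lists the path from the single-arc end to the digon end. The arcs are only bounded from
    above, so that what deletions leave of an ear is covered. *)
Lemma forced_ear (F : digraph) (A : {set F}) (v0 : F) (s : seq F) :
  v0 \in A -> uniq s -> {in s, forall z, z \notin A} ->
  {in A :|: [set z in s] &, forall u w, arc u w ->
    [\/ u \in A /\ w \in A, (u, w) = (v0, last v0 s), (u, w) = (last v0 s, v0) |
     exists2 n, 0 < n <= size s & let t := nth v0 (v0 :: s) in
       u = t n.-1 /\ w = t n \/ [/\ u = t n, w = t n.-1 & ~~ arc w u]]} ->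
  forced A -> forced (A :|: [set z in s]).
Proof.
move=> v0A us sA arcS fA D Y Ycol.
have [s0|s_gt0] := posnP (size s).
  have E : A :|: [set z in s] = A.
    by apply/setP => z; rewrite !inE (size0nil s0) in_nil orbF.
  by rewrite E in Ycol *; apply: fA.
set K := size s in s_gt0 arcS.
have cardS : #|A :|: [set z in s]| = K + #|A|.
  rewrite cardsU (_ : A :&: _ = set0) ?cards0 ?subn0; last first.
    by apply/setP => z; rewrite !inE andbC; apply: contraTF isT => /andP[/sA/negPf->].
  by rewrite addnC cardsE (card_uniqP us).
have [|X /maxsetP[/andP[XY /asboolP colX] Xmax] _] :=
  @maxset_exists D (fun X => (X \subset Y) && `[< colorable X K >]) set0.
  by rewrite sub0set; apply/asboolP/colorable0.
have [k /(colorableU colX) /Ycol|f [P [own [fY fP]]]] := fA D (Y :\: X).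
  by rewrite cardS leq_add2l.
have [] := fY _ v0A; rewrite inE => /andP[vX vY] _.
pose t n := nth v0 (v0 :: s) n.
(* The value false stands for the reverse arc, or for no arc at all. *)
pose dir n := arc (t n.-1) (t n).
have ncol : ~ colorable (f v0 |: X) K.
  move=> col; suff E : f v0 |: X = X by rewrite -E setU11 in vX.
  apply: Xmax; last exact: subsetUr.
  by rewrite subUset sub1set vY XY; apply/asboolP.
have [x [p [q1 [q2 [lab [x0 xp [pq1 uq1 q1X] [pq2 uq2 q2X]]]]]]] :=
  rooted_ear dir vX s_gt0 colX ncol.
pose idx u := index u (v0 :: s).
have uvs : uniq (v0 :: s) by rewrite /= us andbT; apply/negP => /sA; rewrite v0A.
have tK n : n <= K -> idx (t n) = n by move=> nK; rewrite /idx /t index_uniq.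
have ts n : 0 < n <= K -> t n \in s.
  by case: n => // n /andP[_ nK]; rewrite /t /= mem_nth.
have tl : last v0 s = t K by rewrite /t -[K]/(size (v0 :: s)).-1 nth_last.
pose f' u := if u \in A then f u else x (idx u).
have fA' u : u \in A -> f' u = f u by rewrite /f' => ->.
have ft n : n <= K -> f' (t n) = x n.
  case: n => [|n] nK; first by rewrite fA' // x0.
  by rewrite /f' (negPf (sA _ (ts n.+1 nK))) tK.
(* [p n] is listed from [x n.-1] to [x n], hence reversed for an edge towards the root. The maximum
   recovers [n] from the two positions. *)
pose P' u w := if (u \in A) && (w \in A) then P u w
  else if (u, w) == (v0, t K) then q1 else if (u, w) == (t K, v0) then q2
  else let n := maxn (idx u) (idx w) in if dir n then p n else rev (p n).
(* The old subdivision lives in [Y :\: X] and the ear's new vertices in [X], so the two certificates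
   do not clash. *)
pose own' z : F + F * F := if z \in X then match lab z with
  | (0, n) => inl (t n)
  | (1, n) => inr (if dir n then (t n.-1, t n) else (t n, t n.-1))
  | (2, _) => inr (v0, t K)
  | _ => inr (t K, v0) end else own z.
have K0K : 0 < K <= K by rewrite s_gt0 leqnn.
have XY' z : z \in X -> z \in Y by move/(subsetP XY).
have ownY z : z \in Y :\: X -> z \in Y /\ own' z = own z.
  by rewrite inE => /andP[zX zY]; rewrite /own' (negPf zX).
exists f', P', own'; split=> [u|u w].
  rewrite !inE => /orP[uA|us'].
    by rewrite fA' //; have [/ownY[? ->]] := fY _ uA.
  have iu : 0 < idx u <= K.
    rewrite [0 < _]lt0n -(ltnS _ K) -[K.+1]/(size (v0 :: s)) index_mem inE us' orbT andbT.
    by rewrite /idx /=; case: (v0 =P u) => // E; move: (sA _ us'); rewrite -E v0A.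
  have tu : t (idx u) = u by rewrite /t nth_index // inE us' orbT.
  rewrite -{1 2}tu ft; last by case/andP: iu.
  by have [xX lx _ _ _] := xp _ iu; rewrite XY' // /own' xX lx tu.
move=> uS wS auw; rewrite /P'; have := arcS u w uS wS auw.
case: ifP => [/andP[uA wA] _|nA].
  have [pP uP PY] := fP u w uA wA auw.
  rewrite !fA' //; split=> // z zP; have [zY oz] := PY z zP.
  by have [? ->] := ownY _ zY.
case: eqP => [[-> ->] _|n1].
  rewrite (fA' v0) // ft //; split=> // z zq; have [zX lz] := q1X z zq.
  by rewrite XY' // /own' zX lz.
case: eqP => [[-> ->] _|n2].
  rewrite (fA' v0) // ft //; split=> // z zq; have [zX lz] := q2X z zq.
  by rewrite XY' // /own' zX lz.
case=> [[uA wA]|E|E|[n nK /= h]]; first by rewrite uA wA in nA.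
- by rewrite E tl in n1.
- by rewrite E tl in n2.
have nK1 : n <= K by case/andP: nK.
have nK2 : n.-1 <= K by rewrite (leq_trans (leq_pred n)).
have [xX lx px upn pX] := xp n nK.
have -> : maxn (idx u) (idx w) = n.
  by case: h => [[-> ->]|[-> -> _]]; rewrite !tK //;
    [apply/maxn_idPr|apply/maxn_idPl]; apply: leq_pred.
case: h => [[Eu Ew]|[Eu Ew nwu]].
  have dn : dir n by rewrite /dir /t -Eu -Ew.
  rewrite dn Eu Ew !ft //; split=> // [|z /pX[zX lz]].
    by apply: sub_path px => a b; rewrite /step dn.
  by rewrite XY' // /own' zX lz dn.
have dn : dir n = false by rewrite /dir /t -Eu -Ew (negPf nwu).
rewrite dn Eu Ew !ft //; split; last 2 first.
- by rewrite rev_uniq.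
- by move=> z; rewrite mem_rev => /pX[zX lz]; rewrite XY' // /own' zX lz dn.
have := rev_path arc (x n.-1) (rcons (p n) (x n)).
rewrite last_rcons belast_rcons rev_cons => ->.
by apply: sub_path px => a b; rewrite /step dn.
Qed.

(** A subdivision of a digraph restricts to its subdigraphs: the paths of missing arcs are
    dropped. *)
Lemma forced_pull (F G : digraph) (h : G -> F) (S : {set G}) :
  {in S &, injective h} -> {in S &, {homo h : u w / arc u w}} ->
  forced (h @: S) -> forced S.
Proof.
move=> h_inj h_homo fS D Y; rewrite -(card_in_imset h_inj) => /fS[f [P [own [fY fP]]]].
have [g0 _] : exists g0, g0 \in G by apply/card_gt0P/vertex_gt0.
pose g y := odflt g0 [pick u in S | h u == y].
have hK : {in S, cancel h g}.
  move=> u uS; rewrite /g; case: pickP => [w /andP[wS /eqP]|/(_ u)]; last by rewrite /= uS eqxx.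
  exact: h_inj.
exists (f \o h), (fun u w => P (h u) (h w)), (fun z => match own z with
  | inl y => inl (g y) | inr (y, y') => inr (g y, g y') end).
split=> [u uS|u w uS wS uw] /=.
  by have [? ->] := fY _ (imset_f h uS); rewrite hK.
have [pP uP PY] := fP _ _ (imset_f h uS) (imset_f h wS) (h_homo _ _ uS wS uw).
by split=> // z /PY[? ->]; rewrite !hK.
Qed.

Lemma forced_set1 (F : digraph) (x : F) : forced [set x].
Proof.
move=> D Y Ycol; have [Y0|[y yY]] := set_0Vmem Y.
  by have := Ycol 0; rewrite cards1 => H; case: (notF (H _)); rewrite Y0; apply: colorable0.
exists (fun=> y), (fun _ _ => [::]), (fun=> inl x); split=> [u /set1P->//|u w].
by move=> /set1P-> /set1P->; rewrite arc_irr.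
Qed.

(** * Induced subdigraphs of octi *)

Lemma index_pred_ord n (s : seq 'I_n) (i j : 'I_n) :
  sorted (fun i j : 'I_n => j < i) s -> i \in s -> j \in s -> i = j.+1 :> nat ->
  index j s = (index i s).+1.
Proof.
move=> ss iS jS Ei.
have tr : transitive (fun i j : 'I_n => j < i).
  by move=> a b d /= h1 h2; apply: ltn_trans h2 h1.
have us : uniq s by apply: (sorted_uniq tr _ ss) => a; rewrite /= ltnn.
have idx a d : a \in s -> d \in s -> index a s < index d s -> d < a.
  by move=> aS dS; apply: (sorted_ltn_index tr ss).
apply/eqP; rewrite eqn_leq; apply/andP; split; last first.
  rewrite ltnNge; apply/negP; rewrite leq_eqVlt => /predU1P[/index_inj E|/idx].
    by move: Ei; rewrite E // => /eqP; rewrite (ltn_eqF (ltnSn _)).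
  by move=> /(_ jS iS); rewrite Ei ltnNge leqW.
(* An entry placed between [i] and [j] would have a value strictly between [j] and [j.+1]. *)
rewrite leqNgt; apply/negP => lt; have js : index j s < size s by rewrite index_mem.
have lts := ltn_trans lt js.
have lS := mem_nth i lts; have := index_uniq i lts us.
move: (nth i s _) lS => l lS El.
have := idx i l iS lS; have := idx l j lS jS; rewrite El ltnSn lt Ei.
by move=> /(_ isT) h1 /(_ isT); rewrite ltnS leqNgt h1.
Qed.

Lemma ear_arcP (F : digraph) (v0 : F) k (o : 'I_k -> bool) b (i j : 'I_k.+1) :
  let u : ear v0 o b := inr i in let w : ear v0 o b := inr j in
  arc u w -> i = j.+1 :> nat \/ j = i.+1 :> nat /\ ~~ arc w u.
Proof.
move=> u w /existsP[m]; case om: (o m) => /andP[/eqP E1 /eqP E2]; last by left; rewrite E1.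
right; split; first by rewrite E1.
apply/existsP => -[m']; case om': (o m') => /andP[/eqP E3 /eqP E4].
  by move: E2; rewrite E3 -E1 E4 => /eqP; rewrite ltn_eqF // ltnW.
by move: om'; rewrite (_ : m' = m) ?om //; apply: val_inj; rewrite /= -E1.
Qed.

Lemma octus_forced (F : digraph) : octus F -> forall S : {set F}, S != set0 -> forced S.
Proof.
elim=> {F} [F F1|F v0 k o b _ IH|F G _ IH [h h_inj h_homo]] S S0.
- have /cards1P[x ->] : #|S| == 1.
    by rewrite eqn_leq card_gt0 S0 andbT -F1 max_card.
  exact: forced_set1.
- pose G := ear v0 o b; pose inl' (x : F) : G := inl x; pose inr' (i : 'I_k.+1) : G := inr i.
  (* The surviving path vertices, in decreasing order because [forced_ear] starts at the single-arc
     end, here [k], and ends at the digon, here 0. *)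
  pose B := [seq i <- rev (enum 'I_k.+1) | inr' i \in S].
  have tr : transitive (fun i j : 'I_k.+1 => j < i).
    by move=> a c d /= h1 h2; apply: ltn_trans h2 h1.
  have Bs : sorted (fun i j : 'I_k.+1 => j < i) B.
    apply: sorted_filter => //; rewrite rev_sorted.
    by have := iota_ltn_sorted 0 k.+1; rewrite -val_enum_ord sorted_map.
  have memB i : (i \in B) = (inr' i \in S) by rewrite mem_filter mem_rev mem_enum andbT.
  have uB : uniq B by rewrite filter_uniq // rev_uniq enum_uniq.
  have inr_inj : injective inr' by move=> i j [].
  have inlB y s : (inl' y \in map inr' s) = false by apply/negbTE/negP => /mapP[].
  have [/existsP[x xS]|noF] := boolP [exists x, inl' x \in S].
    pose A := S :&: [set inl' y | y : F].
    have inlA y : (inl' y \in A) = (inl' y \in S).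
      by rewrite inE imset_f ?andbT.
    have inrA i : (inr' i \in A) = false.
      by rewrite inE; apply/negbTE/negP => /andP[_ /imsetP[]].
    have [v1 v1A Ev1] : exists2 v1, v1 \in A & inl' v0 \in S -> v1 = inl' v0.
      by exists (if inl' v0 \in S then inl' v0 else inl' x); case: ifP; rewrite ?inlA.
    have SE : S = A :|: [set z in map inr' B].
      apply/setP => -[y|i]; rewrite in_setU.
        by rewrite -/(inl' y) inlA in_set inlB orbF.
      by rewrite -/(inr' i) inrA in_set mem_map // memB.
    have tB i : i \in B -> nth v1 (v1 :: map inr' B) (index i B).+1 = inr' i.
      by move=> iB; rewrite /= -(index_map inr_inj) nth_index // map_f.
    have forcedA : forced A.
      apply: (forced_pull (h := fun u : G => if u is inl y then y else v0)).
      - by move=> [y|i] [y'|i']; rewrite ?inrA // => _ _ /= ->.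
      - by move=> [y|i] [y'|i']; rewrite ?inrA.
      - apply: IH; apply/set0Pn; exists x; apply/imsetP; exists (inl' x) => //.
        by rewrite inlA.
    have Bgt i : i \in B -> 0 < (index i B).+1 <= size (map inr' B).
      by rewrite size_map index_mem.
    (* As [B] decreases, a surviving digon end comes last in it and a surviving single-arc end
       first. *)
    have Blast i : i \in B -> i = 0 :> nat -> last v1 (map inr' B) = inr' i.
      move=> iB i0; case/splitPr: iB Bs => B1 B2 /cat_sorted2[_ /= /(order_path_min tr)].
      by rewrite map_cat last_cat; case: B2 => //= l B2; rewrite i0.
    have Bhead i : i \in B -> i = k :> nat -> index i B = 0.
      move=> iB ik; case/splitPr: iB Bs => -[|a B1] B2; first by rewrite /= eqxx.
      move=> /= /(order_path_min tr); rewrite all_cat => /and3P[_ + _].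
      by rewrite ik ltnNge -ltnS ltn_ord.
    rewrite SE; apply: (forced_ear v1A) => //; first by rewrite map_inj_uniq.
      by move=> _ /mapP[i _ ->]; rewrite inrA.
    rewrite -SE => -[y|i] [z|j] uS wS auw.
    + by constructor 1; rewrite !inlA.
    + have /andP[/eqP Ey] := auw; rewrite {y}Ey in uS auw *.
      have jB : j \in B by rewrite memB.
      have [j0 _|j0 /andP[bT /eqP jk]] /= := eqVneq (j : nat) 0.
        by constructor 2; rewrite (Blast j) // Ev1 //.
      constructor 4; exists 1; first by have := Bgt _ jB; rewrite Bhead.
      by left; have := tB _ jB; rewrite (Bhead _ jB jk) /= => ->; rewrite Ev1.
    + have /andP[/eqP Ey] := auw; rewrite {z}Ey in wS auw *.
      have iB : i \in B by rewrite memB.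
      have [i0 _|i0 /andP[bT /eqP ik]] /= := eqVneq (i : nat) 0.
        by constructor 3; rewrite (Blast i) // Ev1 //.
      constructor 4; exists 1; first by have := Bgt _ iB; rewrite Bhead.
      right; have := tB _ iB; rewrite (Bhead _ iB ik) /= => ->; rewrite Ev1 //; split=> //.
      by apply/negP => /andP[_]; rewrite (negPf i0) (negPf bT).
    have iB : i \in B by rewrite memB.
    have jB : j \in B by rewrite memB.
    constructor 4; have [ij|[ji nji]] := ear_arcP auw.
      exists (index j B).+1; first exact: Bgt.
      by left; rewrite tB // -pred_Sn (index_pred_ord Bs iB jB ij) tB.
    exists (index i B).+1; first exact: Bgt.
    by right; rewrite tB // -pred_Sn (index_pred_ord Bs jB iB ji) tB.
  (* No vertex of [F] survives: the first remaining path vertex becomes the root, and the others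
     form the path. *)
  have noinl y : (inl' y \in S) = false.
    by apply: contraNF noF => yS; apply/existsP; exists y.
  case: B Bs memB uB => [|i0 B] Bs memB uB.
    by case/set0Pn: S0 => -[y|i]; [rewrite -/(inl' y) noinl|rewrite -/(inr' i) -memB].
  have SE : S = [set inr' i0] :|: [set z in map inr' B].
    apply/setP => -[y|i]; rewrite in_setU !inE.
      by rewrite -/(inl' y) noinl inlB.
    by rewrite -/(inr' i) mem_map // -memB inE.
  have tB i : i \in i0 :: B -> nth (inr' i0) (inr' i0 :: map inr' B) (index i (i0 :: B)) = inr' i.
    move=> iB; rewrite -[_ :: map _ _]/(map inr' (i0 :: B)) -(index_map inr_inj).
    by rewrite nth_index // map_f.
  rewrite SE; apply: (forced_ear (set11 _)).
  + by rewrite map_inj_uniq //; case/andP: uB.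
  + move=> _ /mapP[i iB ->]; rewrite inE; case/andP: uB => i0B _.
    by apply: contraNneq i0B => /inr_inj <-.
  + rewrite -SE => -[y|i] [z|j]; rewrite -/(inl' _) -/(inr' _) ?noinl // => uS wS auw.
    have iB : i \in i0 :: B by rewrite memB.
    have jB : j \in i0 :: B by rewrite memB.
    have bd l : l \in i0 :: B -> index l (i0 :: B) <= size (map inr' B).
      by rewrite size_map -ltnS -[(size B).+1]/(size (i0 :: B)) index_mem.
    constructor 4; have [ij|[ji nji]] := ear_arcP auw.
      have E := index_pred_ord Bs iB jB ij.
      exists (index j (i0 :: B)); first by rewrite bd // E.
      by left; rewrite tB // E tB.
    have E := index_pred_ord Bs jB iB ji.
    exists (index i (i0 :: B)); first by rewrite bd // E.
    by right; rewrite tB // E tB.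
  exact: forced_set1.
- apply: (forced_pull (h := h)); first by move=> u w _ _; apply: h_inj.
    by move=> u w _ _; apply: h_homo.
  by apply: IH; case/set0Pn: S0 => u uS; apply/set0Pn; exists (h u); apply: imset_f.
Qed.

(** * Subdivisions as embeddings, and the two bounds *)

Lemma subdivides_contains (F D : digraph) (Y : {set D}) :
  subdivides [set: F] Y -> contains_subdivision D F.
Proof.
move=> [f [P [own [fY fP]]]].
pose Pa (a : arc_of F) := P (val a).1 (val a).2.
have {fP}Pa_path a : [/\ path arc (f (val a).1) (rcons (Pa a) (f (val a).2)),
    uniq (Pa a) & {in Pa a, forall z, own z = inr (val a)}].
  have [pP uP PY] := fP _ _ (in_setT _) (in_setT _) (valP a).
  by split=> // z /PY[_ ->]; case: (val a).
exists (fun a => size (Pa a)).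
pose g (u : subdivision (fun a => size (Pa a))) : D := match u with
  | inl x => f x | inr p => nth (f (val (tag p)).1) (Pa (tag p)) (tagged p) end.
have own_inl x : own (f x) = inl x by have [_ ->] := fY _ (in_setT x).
have own_inr p : own (g (inr p)) = inr (val (tag p)).
  by have [_ _] := Pa_path (tag p); apply; apply: mem_nth.
(* Injectivity: [own] separates branch vertices and distinct paths, and [uniq] the vertices within
   one path. *)
exists g.
  move=> [x|p] [y|q] E; have := congr1 own E; rewrite ?own_inr /g ?own_inl //.
    by case=> ->.
  case=> /val_inj; case: p q E => [a i] [a' j] /= E Ea; case: _ / Ea j E => j /eqP.
  have [_ ua _] := Pa_path a.
  by rewrite nth_uniq ?ltn_ord // => /eqP/val_inj->.
have gP a i : i <= size (Pa a) ->
    arc (nth (f (val a).1) (f (val a).1 :: Pa a) i)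
        (nth (f (val a).1) (rcons (Pa a) (f (val a).2)) i).
  move=> ia; have [/(pathP (f (val a).1))/(_ i) + _ _] := Pa_path a.
  rewrite size_rcons => /(_ ia); rewrite -rcons_cons nth_rcons /= ltnS ia; apply.
move=> [x|[a i]] [y|[a' j]] /=.
- move=> /existsP[a /andP[/eqP Ea /eqP/size0nil Pa0]].
  have Ex : (val a).1 = x by exact: (congr1 fst Ea).
  have Ey : (val a).2 = y by exact: (congr1 snd Ea).
  by have [] := Pa_path a; rewrite Pa0 Ex Ey /= andbT.
- move=> /andP[/eqP-> /eqP->]; have := gP a' 0 isT.
  by rewrite nth_rcons (leq_ltn_trans (leq0n j)).
- move=> /andP[/eqP-> /eqP Ei].
  by have := gP a i.+1 (eq_leq Ei); rewrite nth_rcons ltn_neqAle (introT eqP Ei).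
move=> /andP[/eqP Ea]; case: _ / Ea j => j /eqP Ej.
have ij : i.+1 < size (Pa a) by rewrite -Ej.
by have := gP a i.+1 (ltnW ij); rewrite nth_rcons ij Ej.
Qed.

Lemma colorable_dichromatic (D : digraph) k :
  colorable [set: D] k -> dichromatic D <= k.
Proof.
move=> [c [ck cyc]]; rewrite /dichromatic; case: ex_minnP => m _; apply.
apply/asboolP; have [x _] : exists x, x \in D by apply/card_gt0P/vertex_gt0.
case: k ck => [/(_ x (in_setT x))|k ck]; first by case: (c x).
exists (fun z => inord (c z).-1) => i s ds si.
apply: (cyc s ds _ i.+1) => [z|z /si]; first by rewrite inE.
have /andP[c0 cz] := ck z (in_setT z).
by rewrite inE => /eqP <-; rewrite inordK prednK.
Qed.

Definition complete_digraph (n : nat) (n_gt0 : 0 < n) : digraph.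
Proof.
refine (@Digraph 'I_n (fun x y => x != y) _ _); first by move=> x; rewrite eqxx.
by rewrite card_ord.
Defined.

(** Two vertices of the same colour would form a monochromatic digon. *)
Lemma dichromatic_complete n (n_gt0 : 0 < n) : n <= dichromatic (complete_digraph n_gt0).
Proof.
rewrite /dichromatic; case: ex_minnP => k /asboolP[c cP] _.
have c_inj : injective c.
  move=> x y Ec; apply/eqP; apply: contrapT => /negP xy; apply: (cP (c x) [:: x; y]).
    by split=> //; rewrite /ucycle /= inE xy eq_sym xy.
  by move=> z; rewrite !inE => /orP[] /eqP-> //; rewrite Ec.
by have := leq_card c c_inj; rewrite !card_ord.
Qed.

Theorem theorem7 (F : digraph) (hF : octus F) : is_mader F #|F|.
Proof.
split.
  split=> [|D FD]; first exact: vertex_gt0.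
  apply: (@subdivides_contains _ _ [set: D]); apply: octus_forced => //.
    by rewrite -card_gt0 cardsT vertex_gt0.
  by move=> k /colorable_dichromatic; rewrite cardsT; apply: leq_trans.
(* The complete digraph on [j] vertices must have room for the branch vertices. *)
move=> j [j_gt0 /(_ _ (dichromatic_complete j_gt0))[l [f f_inj _]]].
have := leq_card f f_inj; rewrite card_ord; apply: leq_trans.
by rewrite card_sum leq_addr.
Qed.
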